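(* Let $n \geq 1$, let $H_0 \in \mathbb{C}^{n \times n}$ be Hermitian, let $V=\mathrm{diag}(v_1,\dots,v_n) \in \mathbb{R}^{n \times n}$ be a real diagonal matrix, and set $H := H_0+V$ and $H_t := H_0 + tV$ for $t \in \mathbb{R}$. Assume that the lowest eigenvalue $\lambda_0(H_t)$ of $H_t$ is non-degenerate for all $t \geq 0$, and that $$\langle g(0), V g(0)\rangle_{\mathbb{C}^n} \leq 0,$$ where $g(t) \in \mathbb{C}^n$ denotes the normalized ground state eigenvector of $H_t$. Then: (i) $\lambda_0(H) \leq \lambda_0(H_0)$; (ii) $\lambda_0(H) = \lambda_0(H_0)$ implies that $V|_{\mathrm{supp}(g(0))} = 0$, i.e. $v_j = 0$ for every $j \in \{1,\dots,n\}$ such that the $j$-th component of $g(0)$ is non-zero.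
   Context: For a Hermitian matrix $M$, $\lambda_0(M)$ denotes its lowest eigenvalue; it is non-degenerate if its multiplicity is one. The ground state (eigenvector) $g(t) \in \mathbb{C}^n$ of $H_t$ is an eigenvector of $H_t$ for the eigenvalue $\lambda_0(H_t)$ with $\langle g(t), g(t)\rangle_{\mathbb{C}^n}=1$ (unique up to a phase when $\lambda_0(H_t)$ is non-degenerate). $\langle\cdot,\cdot\rangle_{\mathbb{C}^n}$ is the standard inner product. The support $\mathrm{supp}(g)$ of a vector $g\in\mathbb{C}^n$ is the set of indices at which $g$ has a non-zero component. *)

(* Defs.v *)
From mathcomp Require Import all_boot all_order all_algebra.
From mathcomp Require Import complex.
From mathcomp Require Import boolp classical_sets reals.

Set Implicit Arguments.
Unset Strict Implicit.
Unset Printing Implicit Defensive.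
Import Order.TTheory GRing.Theory Num.Theory.
Local Open Scope ring_scope.
Local Open Scope complex_scope.
Local Open Scope sesquilinear_scope.

(* The order on R[i] only relates numbers with the same imaginary part, so the
   second conjunct includes that every eigenvalue is real. The library's
   [eigenvalue] and [eigenspace] act on row vectors; the eigenvalues and the
   dimensions of the eigenspaces are the same for column vectors. *)
Definition is_lowest_eigenvalue (R : realType) (n : nat) (M : 'M[R[i]]_n)
    (l : R) : Prop :=
  eigenvalue M l%:C /\ forall a : R[i], eigenvalue M a -> l%:C <= a.

(* The default value 0 is never taken for a Hermitian matrix of size n >= 1:
   see [lambda0P]. *)
Definition lambda0 (R : realType) (n : nat) (M : 'M[R[i]]_n) : R :=
  xget 0 [set l : R | is_lowest_eigenvalue M l]%classic.

Definition nondegenerate_lambda0 (R : realType) (n : nat)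
    (M : 'M[R[i]]_n) : Prop :=
  \rank (eigenspace M (lambda0 M)%:C) = 1%N.

Definition inner (R : realType) (n : nat) (u w : 'cV[R[i]]_n) : R[i] :=
  (u ^t* *m w) 0 0.

Definition is_ground_state (R : realType) (n : nat) (M : 'M[R[i]]_n)
    (g : 'cV[R[i]]_n) : Prop :=
  M *m g = (lambda0 M)%:C *: g /\ inner g g = 1.

Definition supp (R : realType) (n : nat) (g : 'cV[R[i]]_n) : {set 'I_n} :=
  [set j | g j 0 != 0].

Definition diagV (R : realType) (n : nat) (v : 'rV[R]_n) : 'M[R[i]]_n :=
  diag_mx (map_mx (real_complex R) v).

Definition Ht (R : realType) (n : nat) (H0 : 'M[R[i]]_n) (v : 'rV[R]_n)
    (t : R) : 'M[R[i]]_n :=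
  H0 + t%:C *: diagV v.

Lemma lambda0P (R : realType) (n : nat) (M : 'M[R[i]]_n) :
  (0 < n)%N -> M \is hermsymmx -> is_lowest_eigenvalue M (lambda0 M).
Proof.
move=> n_gt0 hM.
suff [l hl] : exists l, is_lowest_eigenvalue M l.
  exact: (xgetPex 0 (ex_intro _ l hl)).
have /orthomx_spectralP eM := hermitian_normalmx hM.
have Xr := hermitian_spectral_diag_real hM.
set P := spectralmx M in eM; set X := spectral_diag M in eM Xr.
have uP : P \in unitmx := spectral_unit M.
have Xre i : X 0 i = (complex.Re (X 0 i))%:C.
  by rewrite RRe_real //; exact: (mxOverP Xr).
have spec a : eigenvalue M a -> exists i, X 0 i = a.
  case/eigenvalueP => w ew w0.
  have w'0 : w *m invmx P != 0.
    by apply: contra w0 => /eqP e; rewrite -(mulmxKV uP w) e mul0mx.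
  have ew' : (w *m invmx P) *m diag_mx X = a *: (w *m invmx P).
    by rewrite scalemxAl -ew {1}eM !mulmxA mulmxK.
  have [i wi] : exists i, (w *m invmx P) 0 i != 0 by apply/rV0Pn.
  exists i; move/rowP/(_ i): ew'; rewrite mul_mx_diag mxE mulrC [RHS]mxE.
  by move/(mulIf wi).
pose i0 := [arg min_(i < Ordinal n_gt0) complex.Re (X 0 i)]%O.
exists (complex.Re (X 0 i0)); split.
  apply/eigenvalueP; exists (row i0 P); last first.
    apply/eqP => r0; have : row i0 (P *m invmx P) = 0.
      by rewrite row_mul r0 mul0mx.
    rewrite mulmxV // => /rowP/(_ i0); rewrite !mxE eqxx => /eqP.
    by rewrite oner_eq0.
  rewrite -row_mul {1}eM !mulmxA mulmxV // mul1mx -Xre.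
  by rewrite row_mul row_diag_mx -scalemxAl -rowE.
move=> a /spec [i <-]; rewrite (Xre i) lecR /i0.
by case: arg_minP => // j _; apply.
Qed.

(* Main.v *)
Require Import Defs.
From mathcomp Require Import all_boot all_order all_algebra.
From mathcomp Require Import complex.
From mathcomp Require Import reals.
Import Order.TTheory GRing.Theory Num.Theory.
Local Open Scope ring_scope.
Local Open Scope complex_scope.

(** The theorem is the variational principle applied to a single trial vector.
    The ground state [g0] of [H0] is a unit vector, so
    [lambda0 (H0 + V) <= <g0, (H0 + V) g0> = lambda0 H0 + <g0, V g0>], and the
    last term is nonpositive: this is (i). When both ends agree, [g0] attains
    the minimum of the Rayleigh quotient of [H0 + V], and a minimizer is an
    eigenvector ([rayleigh_lambda0_eigenvector]). Comparing
    [(H0 + V) g0 = lambda0 H0 g0] with [H0 g0 = lambda0 H0 g0] leaves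
    [V g0 = 0], which for diagonal [V] says that [v] vanishes on the support of
    [g0].

    Both facts about the Rayleigh quotient follow from [rayleigh_gap]: in
    spectral coordinates [<u, M u> - l <u, u>] is a sum of squared moduli
    weighted by the differences between the eigenvalues of [M] and [l]. For
    [l = lambda0 M] the weights are nonnegative, so the sum is nonnegative, and
    it is zero only when each coordinate of [u] is killed by its weight. *)

Lemma innerDr (R : realType) (n : nat) (u w1 w2 : 'cV[R[i]]_n) :
  inner u (w1 + w2) = inner u w1 + inner u w2.
Proof. by rewrite /inner mulmxDr mxE. Qed.

Lemma innerZr (R : realType) (n : nat) (a : R[i]) (u w : 'cV[R[i]]_n) :
  inner u (a *: w) = a * inner u w.
Proof. by rewrite /inner -scalemxAr mxE. Qed.

Lemma inner_diag_mx (R : realType) (n : nat) (d : 'rV[R[i]]_n)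
    (w : 'cV[R[i]]_n) :
  inner w (diag_mx d *m w) = \sum_i d 0 i * `|w i 0| ^+ 2.
Proof.
rewrite /inner mxE; apply: eq_bigr => i _.
by rewrite mul_diag_mx !mxE normCK mulrCA [_^* * _]mulrC.
Qed.

Lemma eigenvalue_spectral_diag (R : realType) (n : nat) (M : 'M[R[i]]_n)
    (i : 'I_n) :
  M \is hermsymmx -> eigenvalue M (spectral_diag M 0 i).
Proof.
move=> hM; have /orthomx_spectralP eM := hermitian_normalmx hM.
have uP : spectralmx M \in unitmx := spectral_unit M.
(* Since [P M = diag(X) P], the rows of [P] are left eigenvectors. *)
apply/eigenvalueP; exists (row i (spectralmx M)); last first.
  apply/eqP => r0; have : row i (spectralmx M *m invmx (spectralmx M)) = 0.
    by rewrite row_mul r0 mul0mx.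
  rewrite mulmxV // => /rowP/(_ i); rewrite !mxE eqxx => /eqP.
  by rewrite oner_eq0.
rewrite -row_mul [in X in _ *m X]eM !mulmxA mulmxV // mul1mx.
by rewrite row_mul row_diag_mx -scalemxAl -rowE.
Qed.

Lemma lambda0_le_spectral_diag (R : realType) (n : nat) (M : 'M[R[i]]_n)
    (i : 'I_n) :
  M \is hermsymmx -> (lambda0 M)%:C <= spectral_diag M 0 i.
Proof.
move=> hM; have n_gt0 : (0 < n)%N by apply: leq_ltn_trans (ltn_ord i).
by have [_] := lambda0P n_gt0 hM; apply; exact: eigenvalue_spectral_diag.
Qed.

(** The unitary [P = spectralmx M] preserves the inner product and turns [M]
    into a diagonal matrix, so both quadratic forms become weighted sums of the
    same squared moduli. *)
Lemma rayleigh_gap (R : realType) (n : nat) (M : 'M[R[i]]_n) (l : R[i])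
    (u : 'cV[R[i]]_n) :
  M \is hermsymmx ->
  inner u (M *m u) - l * inner u u =
  \sum_i (spectral_diag M 0 i - l) * `|(spectralmx M *m u) i 0| ^+ 2.
Proof.
move=> hM; have /orthomx_spectralP eM := hermitian_normalmx hM.
have uP := spectral_unitarymx M; set P := spectralmx M in eM uP *.
set X := spectral_diag M in eM *.
have PP : invmx P *m P = 1%:M by rewrite mulVmx ?unitarymx_unit.
have -> : inner u (M *m u) = inner (P *m u) (diag_mx X *m (P *m u)).
  by rewrite /inner trmx_mul map_mxM eM invmx_unitary // !mulmxA.
have -> : inner u u = inner (P *m u) (diag_mx (const_mx 1) *m (P *m u)).
  rewrite /inner trmx_mul map_mxM diag_const_mx mul1mx mulmxA.
  by rewrite -(mulmxA _ _ P) -invmx_unitary // PP mulmx1.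
rewrite !inner_diag_mx mulr_sumr -sumrB; apply: eq_bigr => i _.
by rewrite [const_mx _ _ _]mxE mul1r mulrBl.
Qed.

Lemma rayleigh_gap_term_ge0 (R : realType) (n : nat) (M : 'M[R[i]]_n)
    (u : 'cV[R[i]]_n) (i : 'I_n) :
  M \is hermsymmx ->
  0 <= (spectral_diag M 0 i - (lambda0 M)%:C) *
       `|(spectralmx M *m u) i 0| ^+ 2.
Proof.
by move=> hM; rewrite mulr_ge0 ?exprn_ge0 // subr_ge0 lambda0_le_spectral_diag.
Qed.

Lemma lambda0_le_rayleigh (R : realType) (n : nat) (M : 'M[R[i]]_n)
    (u : 'cV[R[i]]_n) :
  M \is hermsymmx -> (lambda0 M)%:C * inner u u <= inner u (M *m u).
Proof.
move=> hM; rewrite -subr_ge0 rayleigh_gap //.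
by apply: sumr_ge0 => i _; exact: rayleigh_gap_term_ge0.
Qed.

(** If the gap vanishes, then so does each of its nonnegative terms: the
    spectral coordinates of [u] live only where the eigenvalue is the lowest
    one, so [M] acts on [u] as that scalar. *)
Lemma rayleigh_lambda0_eigenvector (R : realType) (n : nat) (M : 'M[R[i]]_n)
    (u : 'cV[R[i]]_n) :
  M \is hermsymmx -> inner u (M *m u) = (lambda0 M)%:C * inner u u ->
  M *m u = (lambda0 M)%:C *: u.
Proof.
move=> hM /eqP; rewrite -subr_eq0 rayleigh_gap // => /eqP gap0.
have coordE i : spectral_diag M 0 i * (spectralmx M *m u) i 0 =
    (lambda0 M)%:C * (spectralmx M *m u) i 0.
  have ge0 (j : 'I_n) (_ : true) := rayleigh_gap_term_ge0 _ _ M u j hM.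
  have /eqP := psumr_eq0P ge0 gap0 (isT : xpredT i).
  rewrite mulf_eq0 subr_eq0 expf_eq0 /= normr_eq0.
  by case/orP => /eqP ->; rewrite ?mulr0.
have /orthomx_spectralP eM := hermitian_normalmx hM.
have diagE : diag_mx (spectral_diag M) *m (spectralmx M *m u) =
    (lambda0 M)%:C *: (spectralmx M *m u).
  by apply/colP => i; rewrite mul_diag_mx mxE coordE [RHS]mxE.
by rewrite [in LHS]eM -!mulmxA diagE -scalemxAr mulKmx ?spectral_unit.
Qed.

Lemma hermsymmxD (R : realType) (n : nat) (A B : 'M[R[i]]_n) :
  A \is hermsymmx -> B \is hermsymmx -> A + B \is hermsymmx.
Proof.
move=> /is_hermitianmxP eA /is_hermitianmxP eB; apply/is_hermitianmxP.
by rewrite linearD /= map_mxD scalerDr -eA -eB.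
Qed.

Lemma diagV_hermsymmx (R : realType) (n : nat) (v : 'rV[R]_n) :
  diagV v \is hermsymmx.
Proof.
apply/is_hermitianmxP; rewrite expr0 scale1r /diagV tr_diag_mx map_diag_mx.
by congr diag_mx; apply/rowP => j; rewrite !mxE; exact/esym/conjc_real.
Qed.

Theorem theorem1 (R : realType) (n : nat) (n_ge1 : (1 <= n)%N)
    (H0 : 'M[R[i]]_n) (H0_herm : H0 \is hermsymmx) (v : 'rV[R]_n)
    (nondeg : forall t : R, 0 <= t -> nondegenerate_lambda0 (Ht H0 v t))
    (g : R -> 'cV[R[i]]_n)
    (g_ground : forall t : R, 0 <= t -> is_ground_state (Ht H0 v t) (g t))
    (g0Vg0 : inner (g 0) (diagV v *m g 0) <= 0) :
  lambda0 (H0 + diagV v) <= lambda0 H0 /\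
  (lambda0 (H0 + diagV v) = lambda0 H0 ->
   forall j : 'I_n, j \in supp (g 0) -> v 0 j = 0).
Proof.
have [] := g_ground 0 (lexx 0); rewrite /Ht scale0r addr0.
move: (g 0) g0Vg0 => g0 g0Vg0 eH0 g0_unit.
have hH : H0 + diagV v \is hermsymmx.
  by apply: hermsymmxD => //; exact: diagV_hermsymmx.
have trialE : inner g0 ((H0 + diagV v) *m g0) =
    (lambda0 H0)%:C + inner g0 (diagV v *m g0).
  by rewrite mulmxDl innerDr eH0 innerZr g0_unit mulr1.
have trial_ge := lambda0_le_rayleigh _ _ _ g0 hH.
rewrite g0_unit mulr1 trialE in trial_ge.
split=> [|lambda0E j].
  by rewrite -lecR (le_trans trial_ge) // gerDl.
have V0 : inner g0 (diagV v *m g0) = 0.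
  by apply/le_anti; rewrite g0Vg0 /=; move: trial_ge; rewrite lambda0E lerDl.
have eH : (H0 + diagV v) *m g0 = (lambda0 (H0 + diagV v))%:C *: g0.
  apply: (rayleigh_lambda0_eigenvector _ _ _ _ hH).
  by rewrite trialE V0 addr0 lambda0E g0_unit mulr1.
have Vg0 : diagV v *m g0 = 0.
  rewrite -[LHS](addKr (H0 *m g0)) -mulmxDl eH lambda0E eH0.
  exact: addNr.
rewrite inE => gj_neq0; move/colP/(_ j): Vg0.
rewrite /diagV mul_diag_mx !mxE => /eqP.
by rewrite mulf_eq0 (negPf gj_neq0) orbF => /eqP [].
Qed.
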